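(* The invariant quartic four-fold $\Phi_4(z_1,z_2,z_3,z_4,z_5,z_6)=0$ can be parametrized by the theta constants associated with $\Gamma(13)$: $$\Phi_4(a_1(z),a_2(z),a_3(z),a_4(z),a_5(z),a_6(z))=0.$$
   Context: Here $\Phi_4=(z_3z_4^3+z_1z_5^3+z_2z_6^3)-(z_6z_1^3+z_4z_2^3+z_5z_3^3)+3(z_1z_2z_4z_5+z_2z_3z_5z_6+z_3z_1z_6z_4)$, which is invariant under the six-dimensional projective representation of $PSL(2,13)$ generated by $S,T$ (with $\zeta=e^{2\pi i/13}$, $T=\mathrm{diag}(\zeta^7,\zeta^{11},\zeta^8,\zeta^6,\zeta^2,\zeta^5)$ and $S$ as in Proposition 2.5). With $q=e^{2\pi iz}$, the theta constants are $a_1(z)=q^{121/104}\sum_{n\in\mathbb{Z}}(-1)^nq^{\frac12(13n^2+11n)}$, $a_2(z)=q^{49/104}\sum_n(-1)^nq^{\frac12(13n^2+7n)}$, $a_3(z)=q^{25/104}\sum_n(-1)^nq^{\frac12(13n^2+5n)}$, $a_4(z)=-q^{9/104}\sum_n(-1)^nq^{\frac12(13n^2+3n)}$, $a_5(z)=q^{81/104}\sum_n(-1)^nq^{\frac12(13n^2+9n)}$, $a_6(z)=q^{1/104}\sum_n(-1)^nq^{\frac12(13n^2+n)}$. *)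

(* Defs.v *)
From HB Require Import structures.
From mathcomp Require Import all_boot all_order all_algebra.
From mathcomp Require Export complex.
From mathcomp Require Import all_classical all_reals all_analysis.

Set Implicit Arguments.
Unset Strict Implicit.
Unset Printing Implicit Defensive.

Import Order.TTheory GRing.Theory Num.Theory.
Import numFieldNormedType.Exports.

Local Open Scope ring_scope.
Local Open Scope complex_scope.

Definition Phi4 (K : comPzRingType) (z1 z2 z3 z4 z5 z6 : K) : K :=
  (z3 * z4 ^+ 3 + z1 * z5 ^+ 3 + z2 * z6 ^+ 3)
  - (z6 * z1 ^+ 3 + z4 * z2 ^+ 3 + z5 * z3 ^+ 3)
  + 3 * (z1 * z2 * z4 * z5 + z2 * z3 * z5 * z6 + z3 * z1 * z6 * z4).

Section ThetaConstants.
Variable R : realType.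
Implicit Types (z : R[i]) (r : R) (n : int) (k : nat).

Definition cexp z : R[i] :=
  (expR (complex.Re z) * cos (complex.Im z)) +i* (expR (complex.Re z) * sin (complex.Im z)).

(* For q = e^(2 pi i z), the power q^r with r real is the branch
   e^(2 pi i r z) determined by z. *)
Definition qpow z r : R[i] := cexp ((2 * pi * r)%:C * 'i * z).

(* Sum over all integers n = 0, 1, 2, ... and n = -1, -2, -3, ...
   (Negz m is - (m + 1)), for the topology of the modulus on R[i]. *)
Definition sumZ (F : int -> R[i]) : R[i] :=
  limn (series (fun m => F (Posz m) : R[i]^o))
  + limn (series (fun m => F (Negz m) : R[i]^o)).

Definition theta13 k z : R[i] :=
  qpow z (k%:R ^+ 2 / 104)
  * sumZ (fun n =>
      (-1) ^ n * qpow z ((13 * n%:~R ^+ 2 + k%:R * n%:~R) / 2)).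

Definition a1 z := theta13 11 z.
Definition a2 z := theta13 7 z.
Definition a3 z := theta13 5 z.
Definition a4 z := - theta13 3 z.
Definition a5 z := theta13 9 z.
Definition a6 z := theta13 1 z.

End ThetaConstants.

(* Main.v *)
(* With x = q^(1/104) and E_j = sum_n (-1)^n x^((26 n + 13 - 2 j)^2), the theta
   constants a1, ..., a6 are E_1, E_3, E_4, - E_5, E_2, E_6.  Writing a sum of
   two squares through the half-sum and half-difference of its terms gives
     E_(a+b) E_(a-b) = F_a G_b - G_a F_b,
   where F_a = sum_n x^(2 (26 n + 13 - 2 a)^2) and
   G_a = sum_n x^(2 (26 n - 2 a)^2).  The products E_(a+b) E_(a-b) are thus the
   2 x 2 minors of a matrix with two rows and satisfy the Pluecker relations.
   Since E_(13-j) = E_j, the relations for {0,1,3,4}, {0,2,5,6} and {2,3,4,6}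
   say that each of the three brackets of Phi_4 vanishes. *)
Require Import Defs.
From mathcomp Require Import all_boot all_order all_algebra.
From mathcomp Require Import finmap zify ring lra.
From mathcomp Require Import all_classical all_reals all_analysis.
From mathcomp Require Import summability.

Set Implicit Arguments.
Unset Strict Implicit.
Unset Printing Implicit Defensive.

Import Order.TTheory GRing.Theory Num.Theory.
Import numFieldNormedType.Exports.

Local Open Scope ring_scope.
Local Open Scope complex_scope.
Local Open Scope classical_set_scope.

Local Existing Instance totally_filter.

(** * Unconditional sums as limits over finite subsets *)

Section UnconditionalSums.
Variable K : numFieldType.

Lemma sum_fsetB (V : zmodType) (T : choiceType) (A B : {fset T}) (f : T -> V) :
  (A `<=` B)%fset ->
  \sum_(i <- B) f i - \sum_(i <- A) f i = \sum_(i <- (B `\` A)%fset) f i.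
Proof.
move=> AB; rewrite (big_fsetID _ (fun x => x \in A) B) /=.
have -> : [fset x in B | x \in A]%fset = A.
  apply/fsetP => x; rewrite !inE; case xA : (x \in A); rewrite ?andbF ?andbT //.
  exact: (fsubsetP AB).
have -> : [fset x in B | x \notin A]%fset = (B `\` A)%fset.
  by apply/fsetP => x; rewrite !inE andbC.
by rewrite addrAC subrr add0r.
Qed.

(** Convergence of the absolute sums along one exhausting family forces unconditional convergence:
    once [D i0] leaves a small absolute tail, any finite set containing it adds only a small
    error. *)
Lemma cvg_totally_exhaustion (T : choiceType) (I : Type) (G : set_system I)
    (FG : ProperFilter G) (D : I -> {fset T}) (h : T -> K) (s S : K) :
  (forall A, \forall i \near G, (A `<=` D i)%fset) ->
  \sum_(t <- D i) h t @[i --> G] --> s ->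
  \sum_(t <- D i) `|h t| @[i --> G] --> S ->
  \sum_(t <- A) h t @[A --> totally] --> s.
Proof.
move=> Dexh /cvgrPdist_lt hs /cvgrPdist_lt hS.
apply/cvgrPdist_lt => e e0.
have e2 : 0 < e / 2 by rewrite divr_gt0.
have e4 : 0 < e / 2 / 2 by rewrite divr_gt0.
have [i0 [/= hi0 Hi0]] : exists i, `|s - \sum_(t <- D i) h t| < e / 2 /\
    `|S - \sum_(t <- D i) `|h t| | < e / 2 / 2.
  by apply/(@filter_ex _ G); apply: filterS2 (hs _ e2) (hS _ e4) => i; split.
exists (D i0) => // B /= DB.
(* A later member of the family traps [B], so what [B] adds to [D i0] is bounded by a difference of
   two absolute sums, each within [e / 2 / 2] of [S]. *)
have [i1 [/= Bi1 Hi1]] : exists i, (B `<=` D i)%fset /\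
    `|S - \sum_(t <- D i) `|h t| | < e / 2 / 2.
  by apply/(@filter_ex _ G); apply: filterS2 (Dexh B) (hS _ e4) => i; split.
have -> : s - \sum_(t <- B) h t = (s - \sum_(t <- D i0) h t)
    - (\sum_(t <- B) h t - \sum_(t <- D i0) h t) by rewrite opprB addrA addrNK.
rewrite (le_lt_trans (ler_normB _ _)) // [e]splitr ltrD //.
rewrite sum_fsetB // (le_lt_trans (ler_norm_sum _ _ _)) //.
have : \sum_(t <- D i1) `|h t| - \sum_(t <- D i0) `|h t| < e / 2.
  rewrite -[ltLHS]ger0_norm; last first.
    rewrite sum_fsetB ?(fsubset_trans DB) //; exact: sumr_ge0.
  have -> : \sum_(t <- D i1) `|h t| - \sum_(t <- D i0) `|h t| =
    (S - \sum_(t <- D i0) `|h t|) - (S - \sum_(t <- D i1) `|h t|) by ring.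
  by rewrite (le_lt_trans (ler_normB _ _)) // [e / 2]splitr ltrD.
apply: le_lt_trans; rewrite -sum_fsetB // lerD2r -subr_ge0 sum_fsetB //.
exact: sumr_ge0.
Qed.

(** This is change of variables: [h] vanishes off the image of [g], so a finite sum of [h] is a
    finite sum of [f] over preimages. It later isolates one parity class of a double sum. *)
Lemma cvg_totally_inj (T U : choiceType) (g : T -> U) (k : U -> T)
    (f : T -> K) (h : U -> K) (s : K) :
  cancel g k -> (forall t, h (g t) = f t) ->
  (forall u, g (k u) != u -> h u = 0) ->
  \sum_(t <- A) f t @[A --> totally] --> s ->
  \sum_(u <- A) h u @[A --> totally] --> s.
Proof.
move=> gk hg h0 fs P /fs [A _ AP].
exists (g @` A)%fset => // B /= AB.
pose B' := (k @` [fset u in B | g (k u) == u])%fset.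
have -> : \sum_(u <- B) h u = \sum_(t <- B') f t.
  rewrite big_imfset /=; last first.
    move=> u v; rewrite !inE => /andP[_ /eqP <-] /andP[_ /eqP <-].
    by rewrite !gk => ->.
  rewrite -big_fset_condE /= [RHS]big_mkcond /=; apply: eq_bigr => u _.
  by case: eqVneq => [{1}<-|/h0//]; rewrite hg.
apply: AP => /=; apply/fsubsetP => t tA.
apply/imfsetP; exists (g t); last by rewrite gk.
by rewrite !inE gk eqxx andbT (fsubsetP AB) // in_imfset.
Qed.

End UnconditionalSums.

(** * Integer windows and products of finite sums *)

(** The window runs from [-N] to [N - 1], so that its sums are exactly the partial sums of the two
    series in [sumZ]. *)
Definition int_window (N : nat) : {fset int} :=
  [fset n in [seq Posz m | m <- iota 0 N] ++ [seq Negz m | m <- iota 0 N]]%fset.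

Lemma in_int_window N n :
  (n \in int_window N) = (match n with Posz m => m | Negz m => m end < N)%N.
Proof.
rewrite [LHS](_ : _ = (n \in [seq Posz m | m <- iota 0 N] ++
  [seq Negz m | m <- iota 0 N])); last by rewrite in_fset.
rewrite mem_cat; case: n => m.
  rewrite mem_map ?mem_iota /=; last by move=> ? ? [].
  rewrite add0n; case: (ltnP m N) => //= _.
  by apply/negbTE/negP => /mapP[].
rewrite orbC mem_map ?mem_iota /=; last by move=> ? ? [].
rewrite add0n; case: (ltnP m N) => //= _.
by apply/negbTE/negP => /mapP[].
Qed.

Lemma sum_int_window (V : nmodType) (f : int -> V) N :
  \sum_(n <- int_window N) f n =
  \sum_(0 <= m < N) f (Posz m) + \sum_(0 <= m < N) f (Negz m).
Proof.
rewrite /index_iota subn0 -[X in X + _](big_map Posz predT).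
rewrite -[X in _ + X](big_map Negz predT) -big_cat.
apply: perm_big; apply: uniq_perm; first exact: fset_uniq.
  rewrite cat_uniq !map_inj_uniq ?iota_uniq ?andbT //=; try by move=> ? ? [].
  by apply/hasPn => _ /mapP[m _ ->]; apply/mapP => -[].
by move=> n; rewrite in_fset.
Qed.

Lemma int_window_exhaustion (A : {fset int}) :
  \forall N \near \oo, (A `<=` int_window N)%fset.
Proof.
exists (\max_(n <- A) `|n|.+1)%N => // N /= AN.
apply/fsubsetP => n nA; rewrite in_int_window.
have : (`|n|.+1 <= N)%N.
  by apply: leq_trans AN;
    apply: (@leq_bigmax_seq _ _ predT (fun n : int => `|n|.+1)%N).
by case: n {nA} => m //=; lia.
Qed.

Lemma sum_fsetM (V : pzSemiRingType) (T U : choiceType) (A : {fset T})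
    (B : {fset U}) (f : T -> V) (g : U -> V) :
  \sum_(p <- (A `*` B)%fset) f p.1 * g p.2 =
  (\sum_(t <- A) f t) * (\sum_(u <- B) g u).
Proof.
rewrite big_distrlr /=.
transitivity (\sum_(p <- [seq (t, u) | t <- A, u <- B]) f p.1 * g p.2);
  last by rewrite big_allpairs.
apply: perm_big; apply: uniq_perm; first exact: fset_uniq.
  apply: allpairs_uniq; rewrite ?fset_uniq //; by move=> [? ?] [? ?].
case=> t u; rewrite in_fsetM.
apply/idP/allpairsP => [/andP[tA uB]|[[a b] [/= aA bB [-> ->]]]].
  by exists (t, u).
by rewrite aA bB.
Qed.

(** * Absolutely convergent complex series over the integers *)

Section ComplexSeries.
Variable R : realType.
Local Notation C := (R[i]).

Lemma normc_real (x : R) : `|x%:C| = `|x|%:C :> C.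
Proof. by rewrite normc_def /= expr0n addr0 sqrtr_sqr. Qed.

Lemma normc_leD (z : C) :
  `|z| <= (`|complex.Re z| + `|complex.Im z|)%:C.
Proof.
rewrite [z in leLHS]complexE (le_trans (ler_normD _ _)) // normrM normc_real.
by rewrite normCi mul1r normc_real -rmorphD.
Qed.

Lemma normc_ge_Im (z : C) : `|complex.Im z|%:C <= `|z|.
Proof.
by rewrite normc_def lecR -sqrtr_sqr ler_wsqrtr // lerDr sqr_ge0.
Qed.

Lemma cvg_complex (I : Type) (F : set_system I) (FF : Filter F)
    (u : I -> C) (a b : R) :
  complex.Re (u i) @[i --> F] --> a -> complex.Im (u i) @[i --> F] --> b ->
  (u i : R[i]^o) @[i --> F] --> (a +i* b : R[i]^o).
Proof.
move=> /cvgrPdist_lt ua /cvgrPdist_lt ub; apply/cvgrPdist_lt => e.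
rewrite ltcE /= => /andP[/eqP e0 er].
have e2 : 0 < complex.Re e / 2 by rewrite divr_gt0.
apply: filterS2 (ua _ e2) (ub _ e2) => i ai bi.
have -> : e = (complex.Re e)%:C by case: e e0 {er e2 ai bi} => ? ? /= ->.
rewrite (le_lt_trans (normc_leD _)) // ltcR [ltRHS]splitr.
by case: (u i) ai bi => x y /= ai bi; rewrite ltrD.
Qed.

Lemma cvg_complex_unique (I : Type) (F : set_system I) (FF : ProperFilter F)
    (u : I -> R[i]^o) (v w : R[i]^o) :
  u i @[i --> F] --> v -> u i @[i --> F] --> w -> v = w.
Proof. by apply: cvg_unique; exact: norm_hausdorff. Qed.

(** The real and imaginary parts are each dominated by the same geometric series. *)
Lemma is_cvg_series_geometric_bound (u : nat -> C) (c r : R) :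
  0 <= r < 1 -> (forall m, `|u m| <= (c * r ^+ m)%:C) ->
  cvgn (series (u : nat -> R[i]^o)).
Proof.
move=> /andP[r0 r1] uc.
have c0 m : 0 <= c * r ^+ m
  by rewrite -lecR; apply: le_trans (uc m); exact: normr_ge0.
have real_cvg (v : nat -> R) : (forall m, `|v m| <= c * r ^+ m) ->
    cvgn (series v).
  move=> vc; apply: normed_cvg; apply: (@series_le_cvg _ _ (geometric c r)).
  - by move=> m; exact: normr_ge0.
  - exact: c0.
  - exact: vc.
  - by apply: is_cvg_geometric_series; rewrite ger0_norm.
have cRe : cvgn (series (fun m => complex.Re (u m))).
  by apply: real_cvg => m; rewrite -lecR (le_trans (normc_ge_Re _)).
have cIm : cvgn (series (fun m => complex.Im (u m))).
  by apply: real_cvg => m; rewrite -lecR (le_trans (normc_ge_Im _)).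
apply/cvg_ex; eexists; apply: (cvg_complex (F := \oo)).
  by under eq_fun do rewrite /series /= raddf_sum; exact: cRe.
by under eq_fun do rewrite /series /= raddf_sum; exact: cIm.
Qed.

Definition geometrically_bounded (f : int -> C) :=
  exists c r : R, 0 <= r < 1 /\ forall m : nat,
    `|f (Posz m)| <= (c * r ^+ m)%:C /\ `|f (Negz m)| <= (c * r ^+ m)%:C.

Lemma geometrically_bounded_norm f :
  geometrically_bounded f -> geometrically_bounded (fun n => `|f n|).
Proof.
by move=> [c [r [rlt fr]]]; exists c, r; split=> // m; rewrite !normr_id.
Qed.

Lemma cvg_int_window f : geometrically_bounded f ->
  (\sum_(n <- int_window N) f n : R[i]^o) @[N --> \oo] --> (sumZ f : R[i]^o).
Proof.
move=> [c [r [rlt fr]]].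
under eq_fun do rewrite sum_int_window.
apply: cvgD; apply: (is_cvg_series_geometric_bound (c := c) rlt).
  by move=> m; have [] := fr m.
by move=> m; have [] := fr m.
Qed.

Lemma cvg_totally_sumZ f : geometrically_bounded f ->
  (\sum_(n <- A) f n : R[i]^o) @[A --> totally] --> (sumZ f : R[i]^o).
Proof.
move=> fb; apply: (@cvg_totally_exhaustion _ _ _ \oo _ int_window).
- exact: int_window_exhaustion.
- exact: cvg_int_window.
- exact: cvg_int_window (geometrically_bounded_norm fb).
Qed.

(** Square windows exhaust the pairs of integers, and over them both the sum and the absolute sum
    factor. The unconditional limit then allows any rearrangement of the double series. *)
Lemma cvg_totally_sumZM f g :
  geometrically_bounded f -> geometrically_bounded g ->
  (\sum_(p <- A) f p.1 * g p.2 : R[i]^o) @[A --> totally]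
    --> (sumZ f * sumZ g : R[i]^o).
Proof.
move=> fb gb.
pose D N := (int_window N `*` int_window N)%fset.
apply: (@cvg_totally_exhaustion _ _ _ \oo _ D (fun p => f p.1 * g p.2) _
  (sumZ (fun n => `|f n|) * sumZ (fun n => `|g n|))).
- move=> A; apply: filterS2 (int_window_exhaustion [fset p.1 | p in A]%fset)
    (int_window_exhaustion [fset p.2 | p in A]%fset) => N.
  move=> /fsubsetP A1 /fsubsetP A2.
  apply/fsubsetP => p pA; rewrite in_fsetM A1 ?A2 //; exact: in_imfset.
- under eq_fun do rewrite sum_fsetM.
  by apply: cvgM; exact: cvg_int_window.
- under eq_fun do [under eq_bigr do rewrite normrM;
    rewrite (sum_fsetM _ _ (fun n => `|f n|) (fun n => `|g n|))].
  by apply: cvgM; apply: cvg_int_window; exact: geometrically_bounded_norm.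
Qed.

End ComplexSeries.

(** * Theta series and their product formula *)

Section ThetaSeries.
Variable R : realType.
Local Notation C := (R[i]).

Lemma cexpD (v w : C) : cexp (v + w) = cexp v * cexp w.
Proof.
case: v w => [a b] [c d]; rewrite /cexp /= expRD cosD sinD.
by apply/eqP; rewrite eq_complex /=; apply/andP; split; apply/eqP; ring.
Qed.

Lemma norm_cexp (w : C) : `|cexp w| = (expR (complex.Re w))%:C.
Proof.
by rewrite normc_def /= !exprMn -mulrDr cos2Dsin2 mulr1 sqrtr_sqr ger0_norm.
Qed.

Variable z : C.

Lemma qpowD r s : qpow z (r + s) = qpow z r * qpow z s.
Proof. by rewrite /qpow -cexpD mulrDr rmorphD /= !mulrDl. Qed.

Lemma norm_qpow r : `|qpow z r| = (expR (- (2 * pi * complex.Im z * r)))%:C.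
Proof.
rewrite norm_cexp; congr (expR _)%:C.
by case: z => x y /=; ring.
Qed.

Lemma quadratic_ge (a b c x : R) : 0 < a ->
  `|x| - ((`|b| + 1) ^+ 2 / (4 * a) + `|c|) <= a * x ^+ 2 + b * x + c.
Proof.
move=> a0.
have Hc : - `|c| <= c by rewrite lerNl -normrN ler_norm.
have Hb : - (`|b| * `|x|) <= b * x by rewrite -normrM lerNl -normrN ler_norm.
(* The [+ 1] in the centre of the square is what leaves a spare [|x|] after the linear term is
   absorbed. *)
have : 0 <= a * (`|x| - (`|b| + 1) / (2 * a)) ^+ 2.
  by rewrite mulr_ge0 ?sqr_ge0 // ltW.
have -> : a * (`|x| - (`|b| + 1) / (2 * a)) ^+ 2 =
    a * `|x| ^+ 2 - (`|b| + 1) * `|x| + (`|b| + 1) ^+ 2 / (4 * a).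
  by field; rewrite gt_eqF.
rewrite real_normK ?num_real //; lra.
Qed.

Hypothesis hz : 0 < complex.Im z.

(** The modulus of [qpow z r] is [expR (- t * r)] with [t = 2 * pi * Im z > 0]. As the quadratic
    exponent grows at least like [|n|], the ratio [expR (- t) < 1] works. *)
Lemma geometrically_bounded_quadratic (e : int -> C) (a b c : R) :
  0 < a -> (forall n, `|e n| <= 1) ->
  geometrically_bounded
    (fun n => e n * qpow z (a * n%:~R ^+ 2 + b * n%:~R + c)).
Proof.
move=> a0 e1; pose t := 2 * pi * complex.Im z.
have t0 : 0 < t by rewrite !mulr_gt0 ?pi_gt0.
pose d := (`|b| + 1) ^+ 2 / (4 * a) + `|c|.
have bound (m : nat) (n : int) : m%:R <= `|n%:~R : R| ->
    `|e n * qpow z (a * n%:~R ^+ 2 + b * n%:~R + c)|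
      <= (expR (t * d) * expR (- t) ^+ m)%:C.
  move=> mn; rewrite normrM -[leRHS]mul1r ler_pM // norm_qpow lecR.
  rewrite -expRM_natl -expRD ler_expR -/t.
  have : t * (m%:R - d) <= t * (a * n%:~R ^+ 2 + b * n%:~R + c).
    rewrite ler_pM2l //; apply: le_trans (quadratic_ge _ _ _ a0).
    by rewrite lerB.
  lra.
exists (expR (t * d)), (expR (- t)); split.
  by rewrite expR_ge0 expR_lt1 oppr_lt0.
by move=> m; split; apply: bound; rewrite ?NegzE ?mulrNz ?normrN;
  rewrite normr_nat ler_nat.
Qed.

(** In the notation of the opening comment, E_j is [theta_odd (13 - 2 * j)]. *)
Definition theta_odd (k : int) : C :=
  sumZ (fun n => (-1) ^ n * qpow z ((26 * n%:~R + k%:~R) ^+ 2 / 104)).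

(** F_a and G_a are the values at [13 - 2 * a] and [- (2 * a)]; the halved denominator 52 is the
    factor 2 in their exponents. *)
Definition theta_double (k : int) : C :=
  sumZ (fun n => qpow z ((26 * n%:~R + k%:~R) ^+ 2 / 52)).

Lemma norm_signz n : `|(-1 : C) ^ n| = 1.
Proof.
by case: n => m; rewrite ?NegzE -?exprnP -?exprnN ?normfV normrX normrN1
  expr1n ?invr1.
Qed.

Lemma theta_odd_bounded k : geometrically_bounded
  (fun n => (-1) ^ n * qpow z ((26 * n%:~R + k%:~R) ^+ 2 / 104)).
Proof.
have := @geometrically_bounded_quadratic (fun n => (-1) ^ n)
  (13 / 2) (k%:~R / 2) (k%:~R ^+ 2 / 104).
rewrite (_ : (fun n => _) = (fun n : int =>
    (-1) ^ n * qpow z ((26 * n%:~R + k%:~R) ^+ 2 / 104))).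
  apply; first by lra.
  by move=> n; rewrite norm_signz.
by apply: funext => n; congr (_ * qpow z _); field.
Qed.

Lemma theta_double_bounded k : geometrically_bounded
  (fun n => qpow z ((26 * n%:~R + k%:~R) ^+ 2 / 52)).
Proof.
have := @geometrically_bounded_quadratic (fun=> 1) 13 k%:~R (k%:~R ^+ 2 / 52).
rewrite (_ : (fun n => _) = (fun n : int =>
    qpow z ((26 * n%:~R + k%:~R) ^+ 2 / 52))).
  by apply; rewrite ?normr1 //; lra.
by apply: funext => n; rewrite mul1r; congr (qpow z _); field.
Qed.

(** The prefactor completes the square: 13n^2/2 + kn/2 + k^2/104 = (26n + k)^2/104. *)
Lemma theta13E (k : nat) : theta13 k z = theta_odd k.
Proof.
have fE n : (-1) ^ n * qpow z ((26 * n%:~R + k%:~R) ^+ 2 / 104) =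
    qpow z (k%:R ^+ 2 / 104) *
    ((-1) ^ n * qpow z ((13 * n%:~R ^+ 2 + k%:R * n%:~R) / 2)).
  rewrite mulrCA -qpowD; congr (_ * qpow z _).
  by rewrite -[k%:~R]/(k%:R); field.
have fb : geometrically_bounded
    (fun n => (-1) ^ n * qpow z ((13 * n%:~R ^+ 2 + k%:R * n%:~R) / 2)).
  have := @geometrically_bounded_quadratic (fun n => (-1) ^ n)
    (13 / 2) (k%:R / 2) 0.
  rewrite (_ : (fun n => _) = (fun n : int =>
      (-1) ^ n * qpow z ((13 * n%:~R ^+ 2 + k%:R * n%:~R) / 2))).
    by apply; [lra | move=> n; rewrite norm_signz].
  by apply: funext => n; congr (_ * qpow z _); field.
apply: cvg_complex_unique (cvg_int_window (theta_odd_bounded k)).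
under eq_fun do under eq_bigr do rewrite fE.
under eq_fun do rewrite -mulr_sumr.
by apply: cvgMl_tmp; exact: cvg_int_window.
Qed.

(** The substitution n -> -n preserves the sign (-1)^n. This is the source of E_(13-j) = E_j. *)
Lemma theta_oddN k : theta_odd (- k) = theta_odd k.
Proof.
apply: esym.
apply: cvg_complex_unique (cvg_totally_sumZ (theta_odd_bounded (- k))).
apply: (cvg_totally_inj (g := -%R) (k := -%R)
  _ _ _ (cvg_totally_sumZ (theta_odd_bounded k))).
- exact: opprK.
- move=> n; congr (_ * qpow z _); first by rewrite -exprz_inv invrN1.
  by rewrite !mulrNz; field.
- by move=> n; rewrite opprK eqxx.
Qed.

Lemma signz_double n : (-1 : C) ^ (2 * n) = 1.
Proof. by rewrite -exprz_exp -[(-1) ^ 2]/((-1) ^+ 2) sqrrN expr1n exp1rz. Qed.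

(* The substitution u = n + n' + 1, v = n - n' diagonalises the sum of two
   squares; u and v have opposite parities, and each parity class splits as a
   product of two one-variable sums. *)
Lemma theta_oddM a b :
  theta_odd (13 - 2 * (a + b)) * theta_odd (13 - 2 * (a - b)) =
  theta_double (13 - 2 * a) * theta_double (- (2 * b))
  - theta_double (- (2 * a)) * theta_double (13 - 2 * b).
Proof.
pose f k (n : int) : C := (-1) ^ n * qpow z ((26 * n%:~R + k%:~R) ^+ 2 / 104).
pose g (k : int) (n : int) : C := qpow z ((26 * n%:~R + k%:~R) ^+ 2 / 52).
pose h (p : int * int) := f (13 - 2 * (a + b)) p.1 * f (13 - 2 * (a - b)) p.2.
pose ev (p : int * int) := (2 %| p.1 + p.2)%Z.
apply: esym; apply: cvg_complex_unique
  (cvg_totally_sumZM (theta_odd_bounded _) (theta_odd_bounded _)).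
have hE p : h p = (if ev p then h p else 0) + (if ev p then 0 else h p).
  by case: ifP; rewrite ?addr0 ?add0r.
under eq_fun do under eq_bigr do rewrite -/(f _ _) -/(f _ _) -/(h _) hE.
under eq_fun do rewrite big_split /=.
apply: cvgD.
(* Even class: the half-sum and half-difference of the two bases are 26i + 13 - 2a and 26j - 2b, and
   the sign is +1. *)
- apply: (cvg_totally_inj (g := fun p => (p.1 + p.2, p.1 - p.2))
    (k := fun p => (((p.1 + p.2) %/ 2)%Z, ((p.1 - p.2) %/ 2)%Z))
    _ _ _ (cvg_totally_sumZM (theta_double_bounded _) (theta_double_bounded _))).
  + by case=> i j /=; congr pair; lia.
  + case=> i j /=; rewrite /ev /= ifT; last by lia.
    rewrite /h /f /= mulrACA -expfzDr ?oppr_eq0 ?oner_eq0 //.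
    rewrite (_ : i + j + (i - j) = 2 * i); last by ring.
    rewrite signz_double mul1r -!qpowD; congr (qpow z _).
    by rewrite !(intrD, intrM, rmorphN, rmorphB) /=; field.
  + move=> [m n] /=; case: ifP => // evp /eqP[].
    by congr pair; rewrite /ev /= in evp; lia.
- have : (- \sum_(p <- A) g (- (2 * a)) p.1 * g (13 - 2 * b) p.2 : R[i]^o)
      @[A --> totally] -->
      (- (theta_double (- (2 * a)) * theta_double (13 - 2 * b)) : R[i]^o).
    apply: cvgN.
    exact: cvg_totally_sumZM (theta_double_bounded _) (theta_double_bounded _).
  under eq_fun do rewrite -sumrN.
  (* Odd class: the shift by 1 moves the 13 from the half-sum to the half-difference, giving 26i -
     2a and 26j + 13 - 2b, with sign -1. *)
  apply: (cvg_totally_inj (g := fun p => (p.1 + p.2, p.1 - p.2 - 1))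
    (k := fun p => (((p.1 + p.2 + 1) %/ 2)%Z, ((p.1 - p.2 - 1) %/ 2)%Z))).
  + by case=> i j /=; congr pair; lia.
  + case=> i j /=; rewrite /ev /= ifF; last by lia.
    rewrite /h /f /= mulrACA -expfzDr ?oppr_eq0 ?oner_eq0 //.
    rewrite (_ : i + j + (i - j - 1) = 2 * i - 1); last by ring.
    rewrite expfzDr ?oppr_eq0 ?oner_eq0 // signz_double mul1r.
    rewrite -[(-1) ^ (-1)]/((-1)^-1) invrN1 mulN1r -!qpowD; congr (- qpow z _).
    by rewrite !(intrD, intrM, rmorphN, rmorphB) /=; field.
  + move=> [m n] /=; case: ifP => // evp /eqP[].
    by congr pair; rewrite /ev /= in evp; lia.
Qed.

End ThetaSeries.

(** * Plücker relations and the vanishing of the quartic *)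

Lemma Phi4_minors (K : comNzRingType) (E F G : int -> K) :
  (forall j, E (13 - j) = E j) ->
  (forall a b, E (a + b) * E (a - b) = F a * G b - G a * F b) ->
  Phi4 (E 1) (E 3) (E 4) (- E 5) (E 2) (E 6) = 0.
Proof.
move=> Erefl EM.
(* This form serves the minors with a + b > 6, whose index is folded back into 1, ..., 6. *)
have EMr a b : E (13 - (a + b)) * E (a - b) = F a * G b - G a * F b.
  by rewrite Erefl EM.
have rel0134 : (E 1 * E 1) * (E 6 * E 1) - (E 3 * E 3) * (E 5 * E 3)
    + (E 4 * E 4) * (E 4 * E 2) = 0.
  rewrite (EM 1 0) (EMr 4 3) (EM 3 0) (EM 4 1) (EM 4 0) (EM 3 1).
  by ring.
have rel0256 : (E 2 * E 2) * (E 2 * E 1) - (E 5 * E 5) * (E 5 * E 4)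
    + (E 6 * E 6) * (E 6 * E 3) = 0.
  rewrite (EM 2 0) (EMr 6 5) (EM 5 0) (EMr 6 2) (EM 6 0) (EMr 5 2).
  by ring.
have rel2346 : (E 5 * E 1) * (E 3 * E 2) - (E 6 * E 2) * (E 4 * E 3)
    + (E 5 * E 4) * (E 6 * E 1) = 0.
  rewrite (EM 3 2) (EMr 6 4) (EM 4 2) (EMr 6 3) (EMr 6 2) (EMr 4 3).
  by ring.
(* The brackets of [Phi4] are, in order, the left sides of [rel0256], [rel0134] and minus that of
   [rel2346]. *)
rewrite -[RHS](subr0 0) -{1}rel0256 -{1}rel0134.
rewrite -[RHS]subr0 -(mulr0 3) -rel2346 /Phi4.
by ring.
Qed.

Theorem theorem3p1 (R : realType) (z : R[i]) (hz : 0 < complex.Im z) :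
  Phi4 (a1 z) (a2 z) (a3 z) (a4 z) (a5 z) (a6 z) = 0.
Proof.
rewrite /a1 /a2 /a3 /a4 /a5 /a6 !theta13E //.
(* At j = 1, 3, 4, 5, 2, 6 the argument 13 - 2j is 11, 7, 5, 3, 9, 1, as in [a1], ..., [a6]. *)
apply: (Phi4_minors (E := fun j => theta_odd z (13 - 2 * j))
  (F := fun a => theta_double z (13 - 2 * a))
  (G := fun a => theta_double z (- (2 * a)))) => [j|a b].
  by rewrite -(theta_oddN hz); congr theta_odd; ring.
exact: theta_oddM.
Qed.
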